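(* Let $\gamma$ be a singular graphon with edge density $p>0$. For any tree or forest $F$ with edge set $E_F$, $t(F,\gamma)=p^{|E_F|}$.
   Context: Graphs are finite, simple and undirected, with at least one vertex. A graph function is a measurable symmetric $g:[0,1]^2\to[0,1]$ (up to null sets); a graphon $\gamma=[g]$ is an equivalence class of graph functions for the relation $\delta_\square=0$, where $\delta_\square$ is the cut-metric $\inf_\sigma \sup_{S,T}|\int_{S\times T}(g_1(\sigma(x),\sigma(y))-g_2(x,y))\,dx\,dy|$, $\sigma$ running over measure-preserving measurable bijections of $[0,1]$ and $S,T$ over measurable subsets. For a graph $F$ on $\{1,\dots,k\}$, $t(F,\gamma)=\int_{[0,1]^k}\prod_{\{i,j\}\in E_F}g(x_i,x_j)\,dx_1\cdots dx_k$. The edge density of $\gamma$ is $p=\int_{[0,1]^2}g(x,y)\,dx\,dy$. For graphs $F_1,F_2$ on $k_1,k_2$ vertices, $F_1F_2$ is their disjoint union and $(F_1\bowtie F_2)(i_1,i_2)$ is the graph obtained from it by identifying vertex $i_1$ of $F_1$ with vertex $i_2$ of $F_2$. The graphon $\gamma$ is singular if for all finite graphs $F_1,F_2$, $t(F_1F_2,\gamma)=\frac1{k_1k_2}\sum_{i_1=1}^{k_1}\sum_{i_2=1}^{k_2}t((F_1\bowtie F_2)(i_1,i_2),\gamma)$. *)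

(* Defs.v *)
From HB Require Import structures.
From mathcomp Require Import all_boot all_order all_algebra.
From mathcomp Require Import all_classical all_reals all_analysis.

Set Implicit Arguments.
Unset Strict Implicit.
Unset Printing Implicit Defensive.
Import Order.TTheory GRing.Theory Num.Theory.
Import numFieldNormedType.Exports.
Local Open Scope classical_set_scope.
Local Open Scope ring_scope.

Record sgraph (k : nat) := SGraph {
  adj :> rel 'I_k ;
  adj_sym : symmetric adj ;
  adj_irr : irreflexive adj }.

(* Each edge {i, j} is listed once, as the pair (i, j) with i < j. *)
Definition edge_set k (F : sgraph k) : {set 'I_k * 'I_k} :=
  [set e : 'I_k * 'I_k | (e.1 < e.2)%N && adj F e.1 e.2]%SET.

(* [ucycle] also accepts back-and-forth walks [:: x; y] along a single edge;
   these are not cycles of the graph, hence the bound 2. *)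
Definition is_forest k (F : sgraph k) : Prop :=
  forall s : seq 'I_k, ucycle (adj F) s -> (size s <= 2)%N.

Definition is_tree k (F : sgraph k) : Prop :=
  is_forest F /\ forall x y, connect (adj F) x y.

Section Combine.
Variables (k1 k2 : nat) (F1 : sgraph k1) (F2 : sgraph k2).

Definition dunion_adj (u v : 'I_(k1 + k2)) : bool :=
  match fintype.split u, fintype.split v with
  | inl a, inl b => adj F1 a b
  | inr a, inr b => adj F2 a b
  | _, _ => false
  end.

Lemma dunion_sym : symmetric dunion_adj.
Proof.
by move=> u v; rewrite /dunion_adj; case: fintype.split => a; case: fintype.split => b //;
  exact: adj_sym.
Qed.

Lemma dunion_irr : irreflexive dunion_adj.
Proof. by move=> u; rewrite /dunion_adj; case: fintype.split => a; exact: adj_irr. Qed.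

Definition dunion : sgraph (k1 + k2) := SGraph dunion_sym dunion_irr.

Variables (i1 : 'I_k1) (i2 : 'I_k2).

(* The first k1 vertices are those of F1, [i1] being also the merged vertex;
   the vertex [rshift k1 b] is the vertex [lift i2 b] <> i2 of F2. *)
Definition glue_adj (u v : 'I_(k1 + k2.-1)) : bool :=
  match fintype.split u, fintype.split v with
  | inl a, inl b => adj F1 a b
  | inr a, inr b => adj F2 (lift i2 a) (lift i2 b)
  | inl a, inr b => (a == i1) && adj F2 i2 (lift i2 b)
  | inr a, inl b => (b == i1) && adj F2 i2 (lift i2 a)
  end.

Lemma glue_sym : symmetric glue_adj.
Proof.
by move=> u v; rewrite /glue_adj; case: fintype.split => a; case: fintype.split => b //;
  exact: adj_sym.
Qed.

Lemma glue_irr : irreflexive glue_adj.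
Proof. by move=> u; rewrite /glue_adj; case: fintype.split => a; exact: adj_irr. Qed.

Definition glue : sgraph (k1 + k2.-1) := SGraph glue_sym glue_irr.

End Combine.

Section LebesgueTuple.
Variable R : realType.
Local Notation mR := (measurableTypeR R).

Definition cons_pair n (z : mR * n.-tuple mR) : n.+1.-tuple mR :=
  [tuple of z.1 :: z.2].

Lemma measurable_cons_pair n : measurable_fun setT (@cons_pair n).
Proof. by apply: measurable_cons; [exact: measurable_fst | exact: measurable_snd]. Qed.

Definition uncons_pair n (t : n.+1.-tuple mR) : mR * n.-tuple mR :=
  (thead t, [tuple of behead t]).

Lemma measurable_uncons_pair n : measurable_fun setT (@uncons_pair n).
Proof.
apply: measurable_fun_pair.
  exact: measurable_tnth.
exact: measurable_behead.
Qed.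

Lemma cons_pairK n : cancel (@cons_pair n) (@uncons_pair n).
Proof.
by move=> [x t]; congr pair; exact: val_inj.
Qed.

Section step.
Variables (n : nat) (m : {sigma_finite_measure set (n.-tuple mR) -> \bar R}).
Local Open Scope ereal_scope.

Definition leb_cons : set (n.+1.-tuple mR) -> \bar R :=
  pushforward (@lebesgue_measure R \x m) (@cons_pair n).

Let mpre (A : set (n.+1.-tuple mR)) :
  measurable A -> measurable (@cons_pair n @^-1` A).
Proof. by move=> mA; rewrite -[X in measurable X]setTI; exact: measurable_cons_pair. Qed.

Let leb_cons0 : leb_cons set0 = 0.
Proof. by rewrite /leb_cons /pushforward preimage_set0 measure0. Qed.

Let leb_cons_ge0 A : 0 <= leb_cons A.
Proof. by rewrite /leb_cons /pushforward measure_ge0. Qed.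

Let leb_cons_sigma_additive : semi_sigma_additive leb_cons.
Proof.
move=> A mA tA mUA; rewrite /leb_cons /pushforward preimage_bigcup.
apply: measure_semi_sigma_additive.
- by move=> i; exact: mpre.
- apply/trivIsetP => /= i j _ _ ij; rewrite -preimage_setI.
  by move/trivIsetP : tA => /(_ _ _ _ _ ij) ->//; rewrite preimage_set0.
- by rewrite -preimage_bigcup; exact: mpre.
Qed.

HB.instance Definition _ := isMeasure.Build _ _ _ leb_cons
  leb_cons0 leb_cons_ge0 leb_cons_sigma_additive.

Let leb_cons_sigma_finite : sigma_finite setT leb_cons.
Proof.
have /sigma_finiteP[A [TA ndA Aoo]] := sigma_finiteT (@lebesgue_measure R).
have /sigma_finiteP[B [TB ndB Boo]] := sigma_finiteT m.
exists (fun i => @uncons_pair n @^-1` (A i `*` B i)).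
  rewrite -preimage_bigcup -[LHS](preimage_setT (@uncons_pair n)).
  congr (_ @^-1` _); apply/esym/seteqP; split=> // -[x t] _.
  have [i _ Aix] : (\bigcup_i A i) x by rewrite -TA.
  have [j _ Bjt] : (\bigcup_i B i) t by rewrite -TB.
  exists (maxn i j) => //; split.
  - by move: x Aix; exact/subsetPset/ndA/leq_maxl.
  - by move: t Bjt; exact/subsetPset/ndB/leq_maxr.
move=> i; have [mA Aioo] := Aoo i; have [mB Bioo] := Boo i; split.
  rewrite -[X in measurable X]setTI; apply: measurable_uncons_pair => //.
  exact: measurableX.
rewrite /leb_cons /pushforward -comp_preimage.
rewrite (_ : _ \o _ = id); last by apply/funext => z; exact: cons_pairK.
by rewrite preimage_id product_measure1E// lte_mul_pinfty// ge0_fin_numE.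
Qed.

HB.instance Definition _ := Measure_isSigmaFinite.Build _ _ _ leb_cons
  leb_cons_sigma_finite.

End step.

(* Lebesgue measure on R^n, as the n-fold product measure: Lebesgue measure on
   R^(n+1) is the product of Lebesgue measure on R (first coordinate) and of
   Lebesgue measure on R^n, transported along (x, t) |-> x :: t. *)
Fixpoint lebesgue_tuple (n : nat) :
    {sigma_finite_measure set (n.-tuple mR) -> \bar R} :=
  match n with
  | 0 => \d_([tuple] : 0.-tuple mR)
  | n'.+1 => leb_cons (lebesgue_tuple n')
  end.

Definition box n (A : 'I_n -> set mR) : set (n.-tuple mR) :=
  [set t | forall i, A i (tnth t i)].

Lemma measurable_box n (A : 'I_n -> set mR) :
  (forall i, measurable (A i)) -> measurable (box A).
Proof.
move=> mA; rewrite (_ : box A = \bigcap_(i in [set: 'I_n])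
    ((fun t : n.-tuple mR => tnth t i) @^-1` A i)); last first.
  by apply/seteqP; split=> t /= At i => [_|]; exact: At.
apply: fin_bigcap_measurable => // i _.
by rewrite -[X in measurable X]setTI; exact: measurable_tnth.
Qed.

Lemma lebesgue_tuple_box n (A : 'I_n -> set mR) :
  (forall i, measurable (A i)) ->
  lebesgue_tuple n (box A) = (\prod_(i < n) lebesgue_measure (A i))%E.
Proof.
elim: n A => [|n IHn] A mA.
  by rewrite big_ord0 /= diracE mem_set //; case.
rewrite big_ord_recl -IHn// -product_measure1E//; last exact: measurable_box.
rewrite /= /leb_cons /pushforward; congr product_measure1.
apply/seteqP; split=> -[x t] /=.
  move=> At; split; first by have := At ord0.
  by move=> i; have := At (lift ord0 i); rewrite tnthS.
move=> [Ax At] i; case: (unliftP ord0 i) => [j|] -> //.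
by rewrite tnthS; exact: At.
Qed.

End LebesgueTuple.

Section Graphons.
Variable R : realType.
Local Notation mR := (measurableTypeR R).
Local Notation leb := (@lebesgue_measure R).
Local Notation leb2 := (leb \x leb)%E.

Definition unit_itv : set mR := `[0, 1].
Definition unit_square : set (mR * mR) := unit_itv `*` unit_itv.
Definition unit_cube (k : nat) : set (k.-tuple mR) := box (fun=> unit_itv).

(* A function on [0,1]^2 is encoded as one on the plane of which only the values
   on the unit square matter: every integral below is over [0,1]^k. *)
Record graph_function := GraphFunction {
  gval :> mR * mR -> R ;
  gval_measurable : measurable_fun unit_square gval ;
  gval_itv : forall z, unit_square z -> 0 <= gval z <= 1 ;
  gval_sym : forall x y, unit_square (x, y) -> gval (x, y) = gval (y, x) }.

Definition mp_bijection (s : mR -> mR) : Prop :=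
  [/\ set_bij unit_itv unit_itv s,
      measurable_fun unit_itv s &
      forall A, measurable A -> A `<=` unit_itv ->
        leb (unit_itv `&` s @^-1` A) = leb A].

Definition cut_norm (f : mR * mR -> R) : \bar R :=
  ereal_sup [set `|\int[leb2]_(z in ST.1 `*` ST.2) (f z)%:E|%E |
    ST in [set ST : set mR * set mR |
      [/\ measurable ST.1, ST.1 `<=` unit_itv,
          measurable ST.2 & ST.2 `<=` unit_itv]]].

Definition cut_dist (g1 g2 : graph_function) : \bar R :=
  ereal_inf [set cut_norm (fun z => g1 (s z.1, s z.2) - g2 z) |
    s in mp_bijection].

(* The graphon [g], as an equivalence class of graph functions. *)
Definition graphon_of (g : graph_function) : set graph_function :=
  [set h | cut_dist g h = 0%E].

Record graphon := Graphon {
  graphon_class : set graph_function ;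
  graphonP : exists g, graphon_class = graphon_of g }.

(* The density t(F, gamma), the edge density and the singularity of a graphon
   gamma = [g] are computed on a representative g; they depend on the class of g
   only. *)
Definition hom_density k (F : sgraph k) (g : graph_function) : R :=
  \int[lebesgue_tuple R k]_(x in @unit_cube k)
    \prod_(e in edge_set F) g (tnth x e.1, tnth x e.2).

Definition edge_density (g : graph_function) : R :=
  \int[leb2]_(z in unit_square) g z.

Definition singular (g : graph_function) : Prop :=
  forall k1 k2 (F1 : sgraph k1) (F2 : sgraph k2), (0 < k1)%N -> (0 < k2)%N ->
    hom_density (dunion F1 F2) g =
      (k1 * k2)%:R^-1 *
        \sum_(i1 < k1) \sum_(i2 < k2) hom_density (glue F1 F2 i1 i2) g.

End Graphons.

(* Main.v *)
Require Import Defs.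
From HB Require Import structures.
From mathcomp Require Import all_boot all_order all_algebra.
From mathcomp Require Import all_classical all_reals all_analysis.
From mathcomp Require Import measurable_realfun ring.
Import Order.TTheory GRing.Theory Num.Theory.
Import numFieldNormedType.Exports.
Local Open Scope classical_set_scope.
Local Open Scope ring_scope.

Set Implicit Arguments.
Unset Strict Implicit.
Unset Printing Implicit Defensive.

(** Singularity is needed for a single pair of graphs: take both to be the
    edge K2. The disjoint union has density [p ^ 2], while each of the four
    gluings is a path with two edges, whose density is the integral of
    [d ^ 2], where [d y] is the degree of [y], the integral of [g (x, y)] over
    [x]. As [d] has mean [p], the equality says that [d] has zero variance
    ([singular_integral_degree_sq], [degree_ae_constant]): almost every point
    has degree [p].

    In such a regular graphon a leaf can be integrated out: the variable of
    the leaf occurs in one factor only, and integrating that factor gives the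
    degree of the neighbour, almost surely [p] ([integral_weight_leaf]); an
    isolated vertex contributes a factor 1 ([integral_weight_isolated]). Every
    nonempty forest has a vertex of one of these two kinds ([forest_leaf]), and
    deleting it leaves a forest, so that induction on the number of vertices
    gives [p] to the number of edges ([integral_weight_forest]).

    Since the vertex to be deleted can be any one, Fubini's theorem is needed
    for an arbitrary coordinate of a tuple ([integral_insert]). The indicator
    of the unit cube is made a part of the integrand ([weight]), so that all
    integrals are over the whole space and no domain has to be carried along. *)

(** * Integration over tuples, one coordinate at a time *)

Section TupleFubini.
Variable R : realType.
Local Notation mR := (measurableTypeR R).
Local Notation leb := (@lebesgue_measure R).
Local Open Scope ereal_scope.

Definition insert n (i : 'I_n.+1) (x : mR) (t : n.-tuple mR) : n.+1.-tuple mR :=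
  [tuple if unlift i j is Some j' then tnth t j' else x | j < n.+1].

Lemma tnth_insert n i x (t : n.-tuple mR) : tnth (insert i x t) i = x.
Proof. by rewrite tnth_mktuple unlift_none. Qed.

Lemma tnth_insert_lift n i x (t : n.-tuple mR) j :
  tnth (insert i x t) (lift i j) = tnth t j.
Proof. by rewrite tnth_mktuple liftK. Qed.

Lemma insert0 n x (t : n.-tuple mR) : insert ord0 x t = cons_pair (x, t).
Proof.
apply: eq_from_tnth => j; case: (unliftP ord0 j) => [j'|] ->.
  by rewrite tnth_insert_lift tnthS.
by rewrite tnth_insert.
Qed.

Lemma insert_lift0 n (i : 'I_n.+1) x y (t : n.-tuple mR) :
  insert (lift ord0 i) y (cons_pair (x, t)) = cons_pair (x, insert i y t).
Proof.
apply: eq_from_tnth => j; case: (unliftP (lift ord0 i) j) => [j'|] ->.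
  rewrite tnth_insert_lift; case: (unliftP ord0 j') => [j''|] ->.
    rewrite [LHS]tnthS /=.
    have -> : lift (lift ord0 i) (lift ord0 j'') = lift ord0 (lift i j'').
      by apply: val_inj; rewrite /= /bump /= !add1n ltnS addnS.
    by rewrite [RHS]tnthS tnth_insert_lift.
  by have -> : lift (lift ord0 i) ord0 = ord0 by exact: val_inj.
by rewrite tnth_insert [RHS]tnthS tnth_insert.
Qed.

Lemma measurable_insert n (i : 'I_n.+1) :
  measurable_fun setT (fun z : mR * n.-tuple mR => insert i z.1 z.2).
Proof.
apply/measurable_fun_tnthP => j; case: (unliftP i j) => [j'|] ->.
  rewrite (_ : _ \o _ = (fun t => tnth t j') \o snd); last first.
    by apply/funext => z /=; rewrite tnth_insert_lift.
  exact: measurableT_comp (measurable_tnth _) measurable_snd.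
rewrite (_ : _ \o _ = fst); first exact: measurable_fst.
by apply/funext => z /=; rewrite tnth_insert.
Qed.

Lemma integral_cons n (h : n.+1.-tuple mR -> \bar R) :
  measurable_fun setT h -> (forall t, 0 <= h t) ->
  \int[lebesgue_tuple R n.+1]_t h t =
  \int[leb]_x \int[lebesgue_tuple R n]_t h (cons_pair (x, t)).
Proof.
move=> mh h0.
have mc := @measurable_cons_pair R n.
transitivity (\int[(leb \x lebesgue_tuple R n)]_z (h (cons_pair z))).
  rewrite -[RHS]/(\int[_]_(z in (@cons_pair R n) @^-1` setT)
    (h \o @cons_pair R n) z).
  by rewrite -ge0_integral_pushforward.
rewrite fubini_tonelli1//.
exact: measurableT_comp mc.
Qed.

Lemma measurable_fun_cons n (h : n.+1.-tuple mR -> \bar R) x :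
  measurable_fun setT h -> measurable_fun setT (fun t => h (cons_pair (x, t))).
Proof.
move=> mh; apply: measurableT_comp => //.
exact: measurable_fun_pair2 (@measurable_cons_pair R _).
Qed.

(** Induction on the position: to extract the coordinate [i + 1], split off the
    first one, extract [i] from the rest, and exchange the two outer
    integrals. *)
Lemma integral_insert n (i : 'I_n.+1) (h : n.+1.-tuple mR -> \bar R) :
  measurable_fun setT h -> (forall t, 0 <= h t) ->
  \int[lebesgue_tuple R n.+1]_t h t =
  \int[leb]_x \int[lebesgue_tuple R n]_t h (insert i x t).
Proof.
elim: n i h => [|n IHn] i h mh h0.
  rewrite integral_cons// (ord1 i).
  by under eq_integral do under eq_integral do rewrite -insert0.
case: (unliftP ord0 i) => [j|] ->; last first.
  rewrite integral_cons//.
  by under eq_integral do under eq_integral do rewrite -insert0.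
(* the integrand after both extractions; it is integrated over the last
   component before the two real variables are exchanged *)
pose f3 (z : (mR * mR) * n.-tuple mR) := h (cons_pair (z.1.1, insert j z.1.2 z.2)).
have mf3 : measurable_fun setT f3.
  apply: measurableT_comp => //.
  apply: measurable_cons; first exact: measurableT_comp measurable_fst measurable_fst.
  pose A (z : (mR * mR) * n.-tuple mR) := (z.1.2, z.2).
  rewrite (_ : (fun _ => _) = (fun z : mR * n.-tuple mR => insert j z.1 z.2) \o A)//.
  apply: measurableT_comp (measurable_insert j) _.
  apply: measurable_fun_pair measurable_snd.
  exact: measurableT_comp measurable_snd measurable_fst.
have mf2 := measurable_fun_fubini_tonelli_F
  (m2 := lebesgue_tuple R n) f3 mf3 (fun=> h0 _).
transitivity (\int[leb]_x \int[leb]_y fubini_F (lebesgue_tuple R n) f3 (x, y)).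
  rewrite integral_cons//; apply: eq_integral => x _.
  by rewrite (IHn j)//; exact: measurable_fun_cons.
have f2_0 z : 0 <= fubini_F (lebesgue_tuple R n) f3 z.
  by apply: integral_ge0 => t _; exact: h0.
transitivity (\int[leb]_y \int[leb]_x fubini_F (lebesgue_tuple R n) f3 (x, y)).
  exact: (fubini_tonelli (m1 := leb) (m2 := leb) _ mf2 f2_0).
apply: eq_integral => y _; rewrite integral_cons//; last first.
  apply: measurableT_comp => //.
  exact: measurable_fun_pair2 (measurable_insert (lift ord0 j)).
apply: eq_integral => x _; apply: eq_integral => t _.
by rewrite insert_lift0.
Qed.

Lemma integral_insert_swap n (i : 'I_n.+1) (h : n.+1.-tuple mR -> \bar R) :
  measurable_fun setT h -> (forall t, 0 <= h t) ->
  \int[lebesgue_tuple R n.+1]_t h t =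
  \int[lebesgue_tuple R n]_t \int[leb]_x h (insert i x t).
Proof.
move=> mh h0; rewrite (integral_insert i)//.
apply: (fubini_tonelli (fun z => h (insert i z.1 z.2))) => //.
exact: measurableT_comp (measurable_insert i).
Qed.

Lemma integral_tuple0 (h : 0.-tuple mR -> \bar R) :
  measurable_fun setT h -> \int[lebesgue_tuple R 0]_t h t = h [tuple].
Proof. by move=> mh; rewrite integral_dirac// diracT mul1e. Qed.

(** The exceptional points lie in a cylinder over a null set: this is a box with
    one null side, hence a null set even though its other sides are infinite. *)
Lemma ae_tnth n (b : 'I_n) (P : mR -> Prop) :
  {ae leb, forall y, P y} ->
  {ae lebesgue_tuple R n, forall t, P (tnth t b)}.
Proof.
move=> [A [mA A0 PA]].
have mB (i : 'I_n) : measurable (if i == b then A else setT) by case: ifP.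
exists (box (fun i => if i == b then A else setT)); split.
- exact: measurable_box.
- by rewrite lebesgue_tuple_box// (bigD1 b)//= eqxx A0 mul0e.
- move=> t /= nPt i; case: ifP => // /eqP ->; exact: PA.
Qed.

End TupleFubini.

(** * Deleting a vertex of a forest *)

Section Forests.

Section DelVertex.
Variables (k : nat) (F : sgraph k.+1) (v : 'I_k.+1).

Definition del_vertex_adj (a b : 'I_k) : bool := adj F (lift v a) (lift v b).

Lemma del_vertex_sym : symmetric del_vertex_adj.
Proof. by move=> a b; exact: adj_sym. Qed.

Lemma del_vertex_irr : irreflexive del_vertex_adj.
Proof. by move=> a; exact: adj_irr. Qed.

Definition del_vertex : sgraph k := SGraph del_vertex_sym del_vertex_irr.

Lemma del_vertex_forest : is_forest F -> is_forest del_vertex.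
Proof.
move=> Ff s /andP[cs us]; rewrite -(size_map (lift v)); apply: Ff.
rewrite /ucycle (map_inj_uniq lift_inj) us andbT.
case: s cs {us} => [//|a s]; rewrite /= -map_rcons path_map.
exact: sub_path.
Qed.

End DelVertex.

(** Otherwise each vertex has, besides any given one, another neighbour. A
    simple path [x :: p] could then always be extended by a neighbour [y] of
    [x] other than the next vertex: were [y] on the path already, the part of
    it up to [y] would be a cycle of length at least 3. Simple paths would be
    arbitrarily long, in a finite graph. *)
Lemma forest_leaf k (F : sgraph k.+1) : is_forest F ->
  exists v, (#|[pred b | adj F v (lift v b)]| <= 1)%N.
Proof.
move=> Ff; apply: contrapT => noleaf.
have other x z : exists2 y, adj F x y & y != z.
  have : (1 < #|[pred b | adj F x (lift x b)]|)%N.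
    by rewrite ltnNge; apply/negP => xleaf; apply: noleaf; exists x.
  case/card_gt1P => a [b] [/= xa xb ab].
  have [az|] := eqVneq (lift x a) z; last by exists (lift x a).
  exists (lift x b) => //; apply: contraNneq ab => bz.
  by apply/eqP/(@lift_inj _ x); rewrite az bz.
have grow n : exists x p, [/\ path (adj F) x p, uniq (x :: p) & size p = n].
  elim: n => [|n [x [p [xp up sp]]]]; first by exists ord0, [::].
  have [y xy yp] := other x (head x p).
  have yx : y != x by apply: contraTneq xy => ->; rewrite adj_irr.
  have ynp : y \notin p.
    apply/negP => /splitPr pE; move: pE xp up yp {sp} => [p1 p2].
    case: p1 => [|a p1] xp up yp; first by rewrite eqxx in yp.
    suff /Ff : ucycle (adj F) (x :: rcons (a :: p1) y) by rewrite /= size_rcons.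
    move: xp up; rewrite -cat_rcons cat_path => /andP[xp _].
    rewrite -cat_cons cat_uniq => /andP[up _].
    rewrite /ucycle up andbT /cycle rcons_path xp last_rcons.
    by rewrite adj_sym xy.
  exists y, (x :: p); split=> /=; last by rewrite sp.
    by rewrite adj_sym xy.
  by rewrite inE negb_or yx ynp.
have [x [p [_ up sp]]] := grow k.+1.
by have := max_card (mem (x :: p)); rewrite (card_uniqP up) /= sp card_ord ltnn.
Qed.

Lemma card_edge_set k (F : sgraph k) :
  #|edge_set F| = (\sum_(i < k) \sum_(j < k) ((i < j) && adj F i j))%N.
Proof.
rewrite pair_bigA /= -sum1_card big_mkcond /=.
by apply: eq_bigr => -[i j] _; rewrite inE /=; case: ifP.
Qed.

Lemma lt_lift k (v : 'I_k.+1) (i j : 'I_k) : (lift v i < lift v j)%N = (i < j)%N.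
Proof.
by rewrite !ltnNge /= leq_bump2.
Qed.

Lemma card_edge_set_del k (F : sgraph k.+1) v :
  #|edge_set F| =
  (#|[pred b | adj F v (lift v b)]| + #|edge_set (del_vertex F v)|)%N.
Proof.
rewrite !card_edge_set (bigD1_ord v)//= (bigD1_ord v)//= ltnn add0n.
under [X in (_ + X)%N]eq_bigr do rewrite (bigD1_ord v)//=.
rewrite big_split/= addnA; congr (_ + _)%N.
  rewrite -sum1_card [RHS]big_mkcond -big_split/=; apply: eq_bigr => b _.
  rewrite inE [adj F (lift v b) v]adj_sym.
  case: (adj F v _); last by rewrite !andbF.
  rewrite !andbT; have := neq_lift v b.
  by rewrite -val_eqE; case: ltngtP.
apply: eq_bigr => a _; apply: eq_bigr => b _.
by rewrite lt_lift.
Qed.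

End Forests.

(** * The integrand of a homomorphism density *)

Section Weights.
Variable R : realType.
Local Notation mR := (measurableTypeR R).
Local Notation leb := (@lebesgue_measure R).
Local Notation I := (@unit_itv R).
Variable g : graph_function R.

(** The extension of [g] by 0 outside of the unit square is measurable, symmetric
    and bounded without any condition on its arguments. *)
Definition kernel0 : mR * mR -> R := g \_ (@unit_square R).
Local Notation G := kernel0.

Lemma measurable_unit_itv : measurable I.
Proof. exact: measurable_itv. Qed.

Lemma measurable_kernel0 : measurable_fun setT G.
Proof.
have mS : measurable (@unit_square R).
  exact: measurableX measurable_unit_itv measurable_unit_itv.
exact: (measurable_restrictT _ mS).1 (gval_measurable g).
Qed.

Lemma kernel0E x y : I x -> I y -> G (x, y) = g (x, y).
Proof. by move=> Ix Iy; rewrite /kernel0 patchE mem_set. Qed.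

Lemma kernel0_out x y : ~ (I x /\ I y) -> G (x, y) = 0.
Proof. by move=> nI; rewrite /kernel0 patchE memNset. Qed.

Lemma kernel0_itv z : 0 <= G z <= 1.
Proof.
case: z => x y; have [[Ix Iy]|nI] := pselect (I x /\ I y).
  by rewrite kernel0E// gval_itv.
by rewrite kernel0_out// lexx ler01.
Qed.

Lemma kernel0_ge0 z : 0 <= G z.
Proof. by case/andP: (kernel0_itv z). Qed.

Lemma kernel0_sym x y : G (x, y) = G (y, x).
Proof.
have [[Ix Iy]|nI] := pselect (I x /\ I y).
  by rewrite !kernel0E// gval_sym.
by rewrite !kernel0_out// => -[Iy Ix]; exact: nI.
Qed.

Lemma indic_kernel0l x y : \1_I x * G (x, y) = G (x, y).
Proof.
rewrite indicE; case: (boolP (x \in I)) => [_|]; first by rewrite mul1r.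
by rewrite notin_setE => nI; rewrite kernel0_out ?mulr0// => -[].
Qed.

Lemma indic_kernel0r x y : \1_I y * G (x, y) = G (x, y).
Proof. by rewrite kernel0_sym indic_kernel0l. Qed.

Definition cube_weight k (x : 'I_k -> mR) : R := \prod_(i < k) \1_I (x i).

(** A double product over the vertices, rather than a product over the edges,
    is easy to split along a vertex or along a sum of vertex sets. *)
Definition edge_weight k (F : sgraph k) (x : 'I_k -> mR) : R :=
  \prod_(i < k) \prod_(j < k) if (i < j)%N && adj F i j then G (x i, x j) else 1.

Definition weight k (F : sgraph k) (x : 'I_k -> mR) : R :=
  cube_weight x * edge_weight F x.

Lemma cube_weight_ge0 k (x : 'I_k -> mR) : 0 <= cube_weight x.
Proof. by apply: prodr_ge0 => i _; rewrite indicE. Qed.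

Lemma edge_weight_ge0 k (F : sgraph k) x : 0 <= edge_weight F x.
Proof.
apply: prodr_ge0 => i _; apply: prodr_ge0 => j _.
by case: ifP => // _; exact: kernel0_ge0.
Qed.

Lemma weight_ge0 k (F : sgraph k) x : 0 <= weight F x.
Proof. by rewrite mulr_ge0 ?cube_weight_ge0 ?edge_weight_ge0. Qed.

Lemma measurable_weight k (F : sgraph k) :
  measurable_fun setT (fun t : k.-tuple mR => weight F (tnth t)).
Proof.
apply: measurable_funM.
  apply: measurable_prod => i _.
  have mI : measurable_fun setT (\1_I : mR -> R).
    exact: measurable_indic measurable_unit_itv.
  exact: measurableT_comp mI (measurable_tnth i).
apply: measurable_prod => i _; apply: measurable_prod => j _.
case: (_ && _) => //; apply: measurableT_comp measurable_kernel0 _.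
by apply: measurable_fun_pair; exact: measurable_tnth.
Qed.

Lemma hom_densityE k (F : sgraph k) :
  hom_density F g = fine (\int[lebesgue_tuple R k]_t (weight F (tnth t))%:E).
Proof.
rewrite /hom_density /Rintegral; congr fine.
rewrite integral_mkcond; apply: eq_integral => t _; rewrite patchE.
case: ifPn => [|nt].
  rewrite inE => It; congr EFin.
  rewrite /weight /cube_weight [X in _ = X * _]big1 ?mul1r.
    rewrite /edge_weight [RHS]pair_bigA [LHS]big_mkcond.
    apply: eq_bigr => -[i j] _ /=.
    by rewrite inE /=; case: ifP => // _; rewrite kernel0E//; exact: It.
  by move=> i _; rewrite indicE mem_set//; exact: It.
rewrite /weight; have [i Ii] : exists i, ~ I (tnth t i).
  by move: nt; rewrite notin_setE => /existsNP.
by rewrite /cube_weight (bigD1 i)//= indicE memNset// !mul0r.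
Qed.

(** The edges of [F] are those at [v] and those of [F] without [v]; as
    [g] is symmetric, [x v] can be made the first argument at each of the
    former, although [v] may be the larger endpoint. *)
Lemma weight_vertex k (F : sgraph k.+1) v (x : 'I_k.+1 -> mR) :
  weight F x = \1_I (x v) *
    (\prod_(b < k) if adj F v (lift v b) then G (x v, x (lift v b)) else 1) *
    weight (del_vertex F v) (x \o lift v).
Proof.
rewrite /weight /cube_weight (bigD1_ord v)//= -!mulrA; congr (_ * _).
rewrite mulrCA; congr (_ * _).
rewrite /edge_weight (bigD1_ord v)//= (bigD1_ord v)//= ltnn mul1r.
under [X in _ * X]eq_bigr do rewrite (bigD1_ord v)//=.
rewrite big_split/= mulrA; congr (_ * _).
  rewrite -big_split/=; apply: eq_bigr => b _.
  rewrite [adj F (lift v b) v]adj_sym [G (x (lift v b), _)]kernel0_sym.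
  case: (adj F v _); last by rewrite !andbF mulr1.
  rewrite !andbT; have := neq_lift v b.
  by rewrite -val_eqE; case: ltngtP; rewrite ?mulr1 ?mul1r.
apply: eq_bigr => a _; apply: eq_bigr => b _.
by rewrite lt_lift.
Qed.

End Weights.

(** * The graphs obtained from two edges *)

Section SmallGraphs.
Variable R : realType.
Local Notation mR := (measurableTypeR R).
Local Notation leb := (@lebesgue_measure R).
Local Notation I := (@unit_itv R).
Variable g : graph_function R.
Local Notation G := (kernel0 g).

Definition K2_adj (i j : 'I_2) : bool := i != j.

Lemma K2_sym : symmetric K2_adj.
Proof. by move=> i j; rewrite /K2_adj eq_sym. Qed.

Lemma K2_irr : irreflexive K2_adj.
Proof. by move=> i; rewrite /K2_adj eqxx. Qed.

Definition K2 : sgraph 2 := SGraph K2_sym K2_irr.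

Lemma edge_weight_K2 (x : 'I_2 -> mR) :
  edge_weight g K2 x = G (x ord0, x (lift ord0 ord0)).
Proof.
by rewrite /edge_weight !big_ord_recl !big_ord0 /= !mulr1 mul1r.
Qed.

Lemma weight_K2 (x : 'I_2 -> mR) :
  weight g K2 x = G (x ord0, x (lift ord0 ord0)).
Proof.
rewrite /weight edge_weight_K2 /cube_weight !big_ord_recl big_ord0 mulr1.
by rewrite -mulrA indic_kernel0r indic_kernel0l.
Qed.

Lemma split_lshift m n (i : 'I_m) : fintype.split (lshift n i) = inl i.
Proof. exact: (unsplitK (inl i)). Qed.

Lemma split_rshift m n (i : 'I_n) : fintype.split (rshift m i) = inr i.
Proof. exact: (unsplitK (inr i)). Qed.

Lemma weight_dunion k1 k2 (F1 : sgraph k1) (F2 : sgraph k2)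
    (x : 'I_(k1 + k2) -> mR) :
  weight g (dunion F1 F2) x =
  weight g F1 (x \o lshift k2) * weight g F2 (x \o @rshift k1 k2).
Proof.
rewrite /weight mulrACA; congr (_ * _); first by rewrite /cube_weight big_split_ord.
rewrite /edge_weight big_split_ord /=; congr (_ * _).
  apply: eq_bigr => i _; rewrite big_split_ord /= [X in _ * X]big1 ?mulr1 => [|j _].
    by apply: eq_bigr => j _; rewrite /dunion_adj !split_lshift.
  by rewrite /dunion_adj split_lshift split_rshift andbF.
apply: eq_bigr => i _; rewrite big_split_ord /= [X in X * _]big1 ?mul1r => [|j _].
  by apply: eq_bigr => j _; rewrite /dunion_adj !split_rshift ltn_add2l.
by rewrite /dunion_adj split_lshift split_rshift andbF.
Qed.

(** An edge between the two parts of the glued graph stands for an edge of [F2]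
    at [i2], so that these edges and those of [F2] without [i2] make up [F2]. *)
Lemma edge_weight_glue k1 k2 (F1 : sgraph k1) (F2 : sgraph k2.+1) i1 i2
    (x : 'I_(k1 + k2) -> mR) :
  edge_weight g (Defs.glue F1 F2 i1 i2) x =
  edge_weight g F1 (x \o lshift k2) *
  (\prod_(b < k2) if adj F2 i2 (lift i2 b)
                  then G (x (lshift k2 i1), x (rshift k1 b)) else 1) *
  edge_weight g (del_vertex F2 i2) (x \o @rshift k1 k2).
Proof.
rewrite /edge_weight big_split_ord /=; congr (_ * _); last first.
  apply: eq_bigr => i _; rewrite big_split_ord /= [X in X * _]big1 ?mul1r => [|j _].
    by apply: eq_bigr => j _; rewrite /glue_adj !split_rshift ltn_add2l.
  by rewrite ltnNge ltnW//= (leq_trans (ltn_ord j))// leq_addr.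
under eq_bigr do rewrite big_split_ord /=.
rewrite big_split /=; congr (_ * _).
  by apply: eq_bigr => i _; apply: eq_bigr => j _; rewrite /glue_adj !split_lshift.
rewrite (bigD1 i1)//= [X in _ * X]big1 ?mulr1 => [|i ii1].
  apply: eq_bigr => b _; rewrite /glue_adj split_lshift split_rshift eqxx /=.
  by rewrite (leq_trans (ltn_ord i1))// leq_addr.
apply: big1 => b _; rewrite /glue_adj split_lshift split_rshift.
by rewrite (negbTE ii1) andbF.
Qed.

(** Whichever endpoints are identified, the result is a path whose middle vertex
    is [lshift 1 i1], the vertex that [y] is assigned to. *)
Lemma weight_glue_K2 (i1 i2 : 'I_2) (y : mR) (s : 2.-tuple mR) :
  weight g (Defs.glue K2 K2 i1 i2) (tnth (insert (lshift 1 i1 : 'I_3) y s)) =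
  G (tnth s ord0, y) * G (tnth s (lift ord0 ord0), y).
Proof.
set c := lshift 1 i1; set t := insert _ _ _.
have tc : tnth t c = y by exact: tnth_insert.
have tl : tnth t (lshift 1 (lift i1 ord0)) = tnth s ord0.
  have -> : lshift 1 (lift i1 ord0) = lift (c : 'I_3) ord0 by exact: val_inj.
  exact: tnth_insert_lift.
have tr : tnth t (rshift 2 (ord0 : 'I_1)) = tnth s (lift ord0 ord0).
  have -> : rshift 2 (ord0 : 'I_1) = lift (c : 'I_3) (lift ord0 ord0).
    apply: val_inj => /=; rewrite /bump /=.
    by move: (ltn_ord i1); rewrite ltnS => ->.
  exact: tnth_insert_lift.
rewrite /weight (edge_weight_glue (k1 := 2) (k2 := 1)) edge_weight_K2.
rewrite big_ord1 {1}/adj /= {1}/K2_adj neq_lift.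
rewrite [edge_weight _ (del_vertex _ _) _]/edge_weight !big_ord1 mulr1.
have -> : G (tnth t (lshift 1 (ord0 : 'I_2)),
    tnth t (lshift 1 (lift ord0 ord0 : 'I_2))) =
    G (tnth s ord0, y).
  rewrite -tc -tl /c; case: (unliftP ord0 i1) => [j|] ->; last exact: kernel0_sym.
  by rewrite (ord1 j); congr (G (tnth t _, tnth t _)); exact: val_inj.
rewrite /= tc tr [G (y, _)]kernel0_sym.
rewrite /cube_weight (bigD1_ord c)//= big_ord_recl big_ord1.
rewrite tc !tnth_insert_lift.
by rewrite [X in X * _]mulrA mulrACA -[X in X * _]mulrA !indic_kernel0l indic_kernel0r.
Qed.

Lemma weight_dunion_K2 (x y : mR) (s : 2.-tuple mR) :
  weight g (dunion K2 K2) (tnth (cons_pair (x, cons_pair (y, s)))) =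
  G (x, y) * weight g K2 (tnth s).
Proof. by rewrite weight_dunion !weight_K2 /= !(tnth_nth 0). Qed.

End SmallGraphs.

(** * Singularity makes the degree constant *)

Section Degree.
Variable R : realType.
Local Notation mR := (measurableTypeR R).
Local Notation leb := (@lebesgue_measure R).
Local Notation I := (@unit_itv R).
Variable g : graph_function R.
Local Notation G := (kernel0 g).
Local Notation p := (edge_density g).
Local Open Scope ereal_scope.

Definition degree (y : mR) : \bar R := \int[leb]_x (G (x, y))%:E.

Let EG0 z : 0 <= (G z)%:E.
Proof. by rewrite lee_fin kernel0_ge0. Qed.

Let mEG : measurable_fun setT (fun z => (G z)%:E).
Proof. apply/measurable_EFinP; exact: measurable_kernel0. Qed.

Lemma degree_ge0 y : 0 <= degree y.
Proof. by apply: integral_ge0 => x _. Qed.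

Lemma measurable_degree : measurable_fun setT degree.
Proof. exact: (measurable_fun_fubini_tonelli_G (m1 := leb) _ mEG EG0). Qed.

Lemma integral_unit_itv : \int[leb]_x (\1_I x)%:E = 1.
Proof.
rewrite integral_indic//; last exact: (@measurable_unit_itv R).
rewrite setIT; have := lebesgue_measure_itv `[0%R : R, 1%R].
by rewrite /= lte_fin ltr01 oppr0 adde0.
Qed.

Let mEI : measurable_fun setT (fun x : mR => (\1_I x : R)%:E).
Proof.
have mI : measurable_fun setT (\1_I : mR -> R)%R.
  exact: measurable_indic (@measurable_unit_itv R).
exact/measurable_EFinP.
Qed.

Lemma degree_le y : degree y <= (\1_I y)%:E.
Proof.
apply: (@le_trans _ _ (\int[leb]_x ((\1_I y)%:E * (\1_I x)%:E))).
  apply: ge0_le_integral => //.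
  - exact: measurable_fun_pair1 mEG.
  - exact: measurable_funeM.
  - move=> x _; rewrite lee_fin -(indic_kernel0l g x) -(indic_kernel0r g x)
      mulrCA mulrA.
    rewrite ler_piMr ?mulr_ge0 ?indicE//.
    by case/andP: (kernel0_itv g (x, y)).
by rewrite ge0_integralZl ?integral_unit_itv ?mule1.
Qed.

Lemma degree_fin_num y : degree y \is a fin_num.
Proof. by rewrite ge0_fin_numE ?degree_ge0// (le_lt_trans (degree_le y))// ltry. Qed.

Lemma integral_degree : \int[leb]_y degree y = p%:E.
Proof.
have le1 : \int[leb]_y degree y <= 1.
  rewrite -integral_unit_itv; apply: ge0_le_integral => //.
  - by move=> y _; exact: degree_ge0.
  - exact: measurable_degree.
  - by move=> y _; exact: degree_le.
have -> : p = fine (\int[leb]_y degree y).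
  rewrite /edge_density /Rintegral; congr fine.
  rewrite integral_mkcond.
  transitivity (\int[leb \x leb]_z (G z)%:E).
    by apply: eq_integral => z _; rewrite /kernel0 !patchE; case: ifP.
  by rewrite fubini_tonelli1// (fubini_tonelli _ mEG EG0).
rewrite fineK// ge0_fin_numE ?integral_ge0// => [|y _]; last exact: degree_ge0.
by rewrite (le_lt_trans le1)// ltry.
Qed.

Lemma integral_kernel0 :
  \int[leb]_x \int[leb]_y (G (x, y))%:E = p%:E.
Proof. by rewrite (fubini_tonelli _ mEG EG0) integral_degree. Qed.

Let mW k (F : sgraph k) :
  measurable_fun setT (fun t : k.-tuple mR => (weight g F (tnth t))%:E).
Proof. apply/measurable_EFinP; exact: measurable_weight. Qed.

Let EW0 k (F : sgraph k) x : 0 <= (weight g F x)%:E.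
Proof. by rewrite lee_fin weight_ge0. Qed.

Lemma integral_weight_K2 :
  \int[lebesgue_tuple R 2]_t (weight g K2 (tnth t))%:E = p%:E.
Proof.
have mK2 := mW K2.
rewrite integral_cons// -integral_kernel0; apply: eq_integral => x _.
rewrite integral_cons//; last exact: (measurable_fun_cons x mK2).
apply: eq_integral => y _; rewrite integral_tuple0 ?weight_K2//.
exact: (measurable_fun_cons y (measurable_fun_cons x mK2)).
Qed.

Lemma integral_weight_dunion_K2 :
  \int[lebesgue_tuple R 4]_t (weight g (dunion K2 K2) (tnth t))%:E = (p * p)%:E.
Proof.
rewrite integral_cons//.
transitivity (\int[leb]_x \int[leb]_y ((G (x, y))%:E * p%:E)).
  apply: eq_integral => x _; rewrite integral_cons//; last first.
    exact: (measurable_fun_cons x (mW (dunion K2 K2))).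
  apply: eq_integral => y _.
  under eq_integral do rewrite weight_dunion_K2 EFinM.
  rewrite ge0_integralZl//; last exact: (mW K2).
  congr mule; exact: integral_weight_K2.
have p0 : 0 <= p%:E.
  by rewrite -integral_degree integral_ge0// => y _; exact: degree_ge0.
transitivity (\int[leb]_x ((\int[leb]_y (G (x, y))%:E) * p%:E)).
  apply: eq_integral => x _; rewrite ge0_integralZr//.
  exact: measurable_fun_pair2 mEG.
rewrite ge0_integralZr//.
- by rewrite integral_kernel0 EFinM.
- exact: (measurable_fun_fubini_tonelli_F (m2 := leb) _ mEG EG0).
- by move=> x _; exact: integral_ge0.
Qed.

(** Given the middle point of the path, its two endpoints are independent. *)
Lemma integral_weight_glue_K2 i1 i2 :
  \int[lebesgue_tuple R 3]_t (weight g (Defs.glue K2 K2 i1 i2) (tnth t))%:E =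
  \int[leb]_y (degree y * degree y).
Proof.
rewrite (integral_insert (lshift 1 i1))//.
apply: eq_integral => y _.
have mGy : measurable_fun setT (fun x : mR => (G (x, y))%:E).
  exact: measurable_fun_pair1 mEG.
have mGyi n (i : 'I_n) :
    measurable_fun setT (fun t : n.-tuple mR => (G (tnth t i, y))%:E).
  exact: measurableT_comp mGy (measurable_tnth i).
under eq_integral do rewrite weight_glue_K2 EFinM.
have mGG := emeasurable_funM (mGyi 2%N ord0) (mGyi 2%N (lift ord0 ord0)).
rewrite integral_cons//; last by move=> t; exact: mule_ge0.
transitivity (\int[leb]_x ((G (x, y))%:E * degree y)).
  apply: eq_integral => x _.
  transitivity (\int[lebesgue_tuple R 1]_t
    ((G (x, y))%:E * (G (tnth t ord0, y))%:E)).
    by apply: eq_integral => t _; rewrite tnthS.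
  rewrite ge0_integralZl//; last exact: (mGyi 1%N ord0).
  congr mule.
  rewrite integral_cons//.
  apply: eq_integral => z _.
  by rewrite integral_tuple0//; exact: (measurable_fun_cons z (mGyi 1%N ord0)).
by rewrite ge0_integralZr//; exact: degree_ge0.
Qed.

Lemma edge_density_ge0 : (0 <= p)%R.
Proof.
rewrite -lee_fin -integral_degree; apply: integral_ge0 => y _.
exact: degree_ge0.
Qed.

(** The four gluings have the same density, so that averaging is harmless. *)
Lemma singular_integral_degree_sq : singular g ->
  \int[leb]_y (degree y * degree y) = (p * p)%:E.
Proof.
move=> /(_ _ _ K2 K2 isT isT).
rewrite hom_densityE integral_weight_dunion_K2 /=.
under eq_bigr do under eq_bigr do rewrite hom_densityE integral_weight_glue_K2.
set B := fine _; rewrite !sumr_const !card_ord -mulrnA -[(B *+ _)%R]mulr_natl.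
rewrite mulKf ?pnatr_eq0// => ->; rewrite {}/B.
rewrite fineK// ge0_fin_numE; last first.
  by apply: integral_ge0 => y _; rewrite mule_ge0 ?degree_ge0.
apply: (@le_lt_trans _ _ (\int[leb]_y degree y)); last first.
  by rewrite integral_degree ltry.
apply: ge0_le_integral => //.
- by move=> y _; rewrite mule_ge0 ?degree_ge0.
- exact: emeasurable_funM measurable_degree measurable_degree.
- exact: measurable_degree.
- move=> y _; rewrite -[leRHS]mule1 lee_wpmul2l ?degree_ge0//.
  by rewrite (le_trans (degree_le y))// lee_fin indicE; case: (_ \in _).
Qed.

Lemma indic_degree y : (\1_I y)%:E * degree y = degree y.
Proof.
rewrite indicE; case: (boolP (y \in I)) => yI; first by rewrite mul1e.
have := degree_le y; rewrite indicE (negbTE yI) mul0e => d0.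
by apply/eqP; rewrite eq_le d0 degree_ge0.
Qed.

(** The function [(degree - p) ^ 2] has integral 0. To stay within nonnegative
    integrands, the double product of the expanded square is moved to the other
    side: [(d - p) ^ 2 + 2 p d = d ^ 2 + p ^ 2] on the unit interval. *)
Lemma degree_ae_constant :
  \int[leb]_y (degree y * degree y) = (p * p)%:E ->
  {ae leb, forall y, degree y = (p * \1_I y)%:E}.
Proof.
move=> sq.
pose D y := fine (degree y).
have DE y : degree y = (D y)%:E by rewrite fineK ?degree_fin_num.
have mD : measurable_fun setT D.
  exact: measurableT_comp (@fine_measurable R setT measurableT) measurable_degree.
have mI : measurable_fun setT (\1_I : mR -> R)%R.
  exact: measurable_indic (@measurable_unit_itv R).
pose q (y : mR) := ((D y - p * \1_I y) ^+ 2)%R.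
have mq : measurable_fun setT (EFin \o q).
  apply/measurable_EFinP; apply: measurable_funX.
  by apply: measurable_funB => //; exact: measurable_funM.
have q0 y : 0 <= (q y)%:E by rewrite lee_fin sqr_ge0.
have p0 := edge_density_ge0.
have : \int[leb]_y ((q y)%:E + (p + p)%:E * degree y) =
       \int[leb]_y (degree y * degree y + (p * p)%:E * (\1_I y)%:E).
  apply: eq_integral => y _.
  have : (\1_I y * D y = D y)%R.
    by apply: EFin_inj; rewrite EFinM -DE indic_degree.
  rewrite DE -!EFinM -!EFinD /q indicE => DI; congr EFin.
  case: (y \in I) DI => /=; rewrite ?mul1r ?mul0r => DI; first by ring.
  by rewrite -DI; ring.
have mdeg := measurable_degree.
have mdeg2 := emeasurable_funM mdeg mdeg.
have pp0 : 0 <= (p + p)%:E by rewrite lee_fin addr_ge0.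
have p20 : 0 <= (p * p)%:E by rewrite lee_fin mulr_ge0.
have deg0 := degree_ge0.
have EI0 (y : mR) : 0 <= (\1_I y : R)%:E by rewrite lee_fin indicE.
rewrite ge0_integralD//; [|by move=> y _; exact: mule_ge0|exact: measurable_funeM].
rewrite ge0_integralZl// integral_degree.
rewrite ge0_integralD//; [|by move=> y _; exact: mule_ge0|
  by move=> y _; exact: mule_ge0|exact: measurable_funeM].
rewrite ge0_integralZl// integral_unit_itv sq mule1.
have -> : (p + p)%:E * p%:E = (p * p)%:E + (p * p)%:E.
  by rewrite -EFinM mulrDl EFinD.
move=> eqi; have intq : \int[leb]_y (q y)%:E = 0.
  have := congr1 (fun z => z - (p * p + p * p)%:E) eqi.
  by rewrite EFinD addeK// subee.
have /(ae_eq_integral_abs leb measurableT mq) : \int[leb]_y `|(q y)%:E| = 0.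
  rewrite -[RHS]intq; apply: eq_integral => y _; exact: gee0_abs.
apply: filterS => y /(_ Logic.I) qy.
have /eqP : q y = 0%R by exact: EFin_inj qy.
rewrite sqrf_eq0 subr_eq0 => /eqP DI.
by rewrite DE DI.
Qed.

(** * Integrating out a vertex of degree at most one *)

Lemma weight_insert k (F : sgraph k.+1) v (x : mR) (t : k.-tuple mR) :
  (weight g F (tnth (insert v x t)) = \1_I x *
    (\prod_(b < k) if adj F v (lift v b) then G (x, tnth t b) else 1) *
    weight g (del_vertex F v) (tnth t))%R.
Proof.
have tE : tnth (insert v x t) \o lift v = tnth t.
  by apply/funext => b /=; exact: tnth_insert_lift.
rewrite (weight_vertex _ _ v) tE tnth_insert; congr (_ * _ * _)%R.
by apply: eq_bigr => b _; rewrite tnth_insert_lift.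
Qed.

Lemma integral_weight_isolated k (F : sgraph k.+1) v :
  (forall b, ~~ adj F v (lift v b)) ->
  \int[lebesgue_tuple R k.+1]_t (weight g F (tnth t))%:E =
  \int[lebesgue_tuple R k]_t (weight g (del_vertex F v) (tnth t))%:E.
Proof.
move=> v0; rewrite (integral_insert_swap v)//; apply: eq_integral => t _.
under eq_integral.
  move=> x _; rewrite weight_insert big1 ?mulr1 => [|b _];
    last by rewrite (negbTE (v0 b)).
  rewrite EFinM; over.
by rewrite ge0_integralZr ?integral_unit_itv ?mul1e.
Qed.

(** Integrating over the leaf first leaves the degree of its neighbour [b]; the
    factor [\1_I] of the almost sure value of this degree is absorbed by the
    weight, which vanishes outside of the unit cube. *)
Lemma integral_weight_leaf k (F : sgraph k.+1) v b :
  {ae leb, forall y, degree y = (p * \1_I y)%:E} ->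
  (forall c, adj F v (lift v c) = (c == b)) ->
  \int[lebesgue_tuple R k.+1]_t (weight g F (tnth t))%:E =
  p%:E * \int[lebesgue_tuple R k]_t (weight g (del_vertex F v) (tnth t))%:E.
Proof.
move=> reg vb; rewrite (integral_insert_swap v)//.
transitivity (\int[lebesgue_tuple R k]_t
    (degree (tnth t b) * (weight g (del_vertex F v) (tnth t))%:E)).
  apply: eq_integral => t _.
  under eq_integral.
    move=> x _; rewrite weight_insert -big_mkcond /= (big_pred1 b) => [|c];
      last exact: vb.
    rewrite indic_kernel0l EFinM; over.
  rewrite ge0_integralZr//; exact: measurable_fun_pair1 mEG.
rewrite -ge0_integralZl//; [|exact: mW|by rewrite lee_fin edge_density_ge0].
apply: ge0_ae_eq_integral => //.
- apply: emeasurable_funM; last exact: mW.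
  exact: measurableT_comp measurable_degree (measurable_tnth b).
- exact: measurable_funeM (mW _).
- by move=> t _; rewrite mule_ge0 ?degree_ge0.
- by move=> t _; rewrite mule_ge0// lee_fin edge_density_ge0.
apply: filterS (ae_tnth b reg) => t degt _.
rewrite degt -!EFinM; congr EFin; rewrite -mulrA; congr (_ * _)%R.
rewrite /weight mulrA; congr (_ * _)%R.
rewrite /cube_weight (bigD1 b)//= mulrA; congr (_ * _)%R.
by rewrite indicE; case: (_ \in _); rewrite ?mulr1 ?mulr0.
Qed.

(** The empty graph is the base case, its cube being a point; deleting a vertex
    of degree at most one takes away one edge or none, and as many factors
    [p]. *)
Lemma integral_weight_forest k (F : sgraph k) :
  {ae leb, forall y, degree y = (p * \1_I y)%:E} -> is_forest F ->
  \int[lebesgue_tuple R k]_t (weight g F (tnth t))%:E = (p ^+ #|edge_set F|)%:E.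
Proof.
move=> reg; elim: k F => [|k IHk] F Ff.
  rewrite integral_tuple0// card_edge_set big_ord0 expr0.
  by rewrite /weight /cube_weight /edge_weight !big_ord0 mulr1.
have [v vleaf] := forest_leaf Ff.
have IH := IHk _ (del_vertex_forest (v := v) Ff).
rewrite (card_edge_set_del F v).
case nv : #|[pred b | adj F v (lift v b)]| vleaf => [|[|//]] _.
  have v0 b : ~~ adj F v (lift v b) by have := card0_eq nv b; rewrite !inE => ->.
  by rewrite (integral_weight_isolated v0) IH.
have /mem_card1[b vb] := nv.
rewrite (integral_weight_leaf reg (v := v) (b := b)) => [|c].
  by rewrite IH -EFinM add1n exprS.
by have := vb c; rewrite !inE.
Qed.

End Degree.

Theorem corollary22 (R : realType) (gamma : graphon R) (g : graph_function R)
    (gamma_g : graphon_class gamma = graphon_of g)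
    (gamma_singular : singular g) (p_gt0 : 0 < edge_density g)
    (k : nat) (k_gt0 : (0 < k)%N) (F : sgraph k)
    (F_forest : is_tree F \/ is_forest F) :
  hom_density F g = edge_density g ^+ #|edge_set F|.
Proof.
have Ff : is_forest F by case: F_forest => // -[].
have reg := degree_ae_constant (singular_integral_degree_sq gamma_singular).
by rewrite hom_densityE integral_weight_forest.
Qed.
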